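(* Let $G$ be a group, let $V$ be a finite-dimensional irreducible complex $G$-module, let $d\ge 3$, and let $0\ne f\in\operatorname{Sym}^d(V^* )$ have $G$-invariant Jacobian $J(f)$. Let $e_1,\dots,e_r$ be the primitive idempotents of the center $Z(f)$, let $V_i=e_iV$ and $f_i=f_{e_i}$, so that $V=V_1\oplus\cdots\oplus V_r$ and $f=f_1+\cdots+f_r$ is the canonical decomposition of $f$. Put $W=V_1$ and $K=\{g\in G: gW=W\}$. Then: (i) $\{h\in\operatorname{Sym}^d(V^* ): J(h)=J(f)\}=\left\{\sum_{i=1}^r c_if_i : c_i\in\mathbb C^\times\right\}$. (ii) The stabilizer $K$ preserves the line $\mathbb C f_1$. Moreover, if $k\cdot f_1=\psi(k)f_1$ $(k\in K)$ for the corresponding linear character $\psi$ of $K$, then $J(f)\cong\operatorname{Ind}_K^G(\psi\otimes W)$ as $G$-modules. (iii) The set $\{h\in\operatorname{Sym}^d(V^* ): J(h)=J(f)\}$ contains a relative invariant of $G$ if and only if $\psi$ extends to a linear character $\chi: G\to\mathbb C^\times$ of $G$. If $\psi$ extends to $\chi$ and $t_1=1,t_2,\dots,t_r$ are representatives of $G/K$, then one such form is $$f_\chi=\sum_{i=1}^r\chi(t_i)^{-1}\,t_i\cdot f_1 .$$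
   Context: $G$ is an arbitrary group acting linearly on $V$; it acts on forms by $(g\cdot h)(x)=h(g^{-1}x)$. For $v\in V$, $D_v$ is directional differentiation, and $J(f)=\langle D_vf: v\in V\rangle\subseteq\operatorname{Sym}^{d-1}(V^* )$ is the Jacobian of $f$; it is $G$-invariant if $g\cdot J(f)=J(f)$ for all $g\in G$. A form $h$ is a relative invariant of $G$ if the line $\mathbb C h$ is $G$-invariant (and $h\neq 0$), i.e. $g\cdot h=\chi(g)h$ for a linear character $\chi$ of $G$. For $f\in\operatorname{Sym}^d(V^* )$, $\Theta_f:V^d\to\mathbb C$ denotes its polarization, the unique symmetric $d$-linear form with $\Theta_f(v,\dots,v)=f(v)$. The form $f$ is nondegenerate if $D_vf=0$ implies $v=0$. The center of $f$ is $$Z(f)=\{X\in\operatorname{End}(V):\Theta_f(Xv_1,v_2,v_3,\dots,v_d)=\Theta_f(v_1,Xv_2,v_3,\dots,v_d)\ \text{for all } v_1,\dots,v_d\in V\}.$$ For nondegenerate $f$ with $d\ge3$, $Z(f)$ is a finite-dimensional commutative $\mathbb C$-algebra (Harrison). For $z\in Z(f)$, $f_z\in\operatorname{Sym}^d(V^* )$ is the form with polarization $\Theta_{f_z}(v_1,\dots,v_d)=\Theta_f(zv_1,v_2,\dots,v_d)$ (symmetric by the center identity). If $e_1,\dots,e_r$ are the primitive idempotents of $Z(f)$, the canonical decomposition of $f$ is $V=V_1\oplus\cdots\oplus V_r$, $V_i=e_iV$ (the canonical blocks), $f=f_1+\cdots+f_r$, where $f_i=f_{e_i}$ is the restriction of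 $f$ to $V_i$ regarded as a form on $V$ via the projection $e_i:V\to V_i$. When $V$ is irreducible, $f\neq 0$ and $J(f)$ is $G$-invariant, $f$ is nondegenerate and $G$ permutes the blocks $V_1,\dots,V_r$ transitively, so $[G:K]=r$. *)

(* Defs.v *)
From HB Require Import structures.
From mathcomp Require Import all_boot all_order all_fingroup all_algebra.
From mathcomp Require Import mpoly.

Set Implicit Arguments.
Unset Strict Implicit.
Unset Printing Implicit Defensive.

Import Order.TTheory GRing.Theory Num.Theory.
Local Open Scope ring_scope.

Section Representations.
Variable F : fieldType.

Record representation (G : groupType) (V : vectType F) := Representation {
  repr_fun :> G -> 'End(V);
  repr_fun1 : repr_fun 1%g = \1%VF;
  repr_funM : forall g h, repr_fun (g * h)%g = (repr_fun g \o repr_fun h)%VF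
}.

Definition irreducible (G : groupType) (V : vectType F)
    (rho : representation G V) : Prop :=
  {:V}%VS != 0%VS /\
  forall U : {vspace V},
    (forall g, (rho g @: U <= U)%VS) -> U = 0%VS \/ U = {:V}%VS.

(* The values outside A are irrelevant; chi 1 = 1 follows from chi 1 != 0. *)
Definition linear_character (G : groupType) (A : {pred G}) (chi : G -> F) :
    Prop :=
  (forall g, g \in A -> chi g != 0) /\
  {in A &, forall g h, chi (g * h)%g = chi g * chi h}.

Definition set_stabilizer (G : groupType) (V : vectType F)
    (rho : representation G V) (U : {vspace V}) : {pred G} :=
  [pred g | (rho g @: U)%VS == U].

(* Only meant for g such that rho g maps U into itself. *)
Definition sub_action (G : groupType) (V : vectType F)
    (rho : G -> 'End(V)) (U : {vspace V}) (g : G) (u : subvs_of U) :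
    subvs_of U :=
  vsproj U (rho g (vsval u)).

(* The tensor product psi (x) M with a one-dimensional module. *)
Definition twist_action (G : groupType) (M : vectType F) (psi : G -> F)
    (sigma : G -> M -> M) (k : G) (u : M) : M :=
  psi k *: sigma k u.

(* Ind_K^G M = C[G] (x)_{C[K]} M, realised as the functions phi : G -> M with
   phi (g k) = k^-1 phi(g) supported on finitely many left cosets of K;
   g (x) m corresponds to the function supported on gK with g k |-> k^-1 m,
   and G acts by (x phi)(g) = phi(x^-1 g). Only sigma on K is used. *)
Definition in_Ind (G : groupType) (K : {pred G}) (M : vectType F)
    (sigma : G -> M -> M) (phi : G -> M) : Prop :=
  (forall g k, k \in K -> phi (g * k)%g = sigma k^-1%g (phi g)) /\
  exists s : seq G, forall g, phi g != 0 ->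
    exists2 t, t \in s & (t^-1 * g)%g \in K.

Definition iso_Ind (G : groupType) (K : {pred G}) (N M : vectType F)
    (tau : G -> N -> N) (sigma : G -> M -> M) : Prop :=
  exists Phi : N -> G -> M,
    [/\ forall a u v g, Phi (a *: u + v) g = a *: Phi u g + Phi v g,
        forall x u g, Phi (tau x u) g = Phi u (x^-1 * g)%g,
        forall u v, Phi u =1 Phi v -> u = v
      & forall phi, in_Ind K sigma phi <-> exists u, Phi u =1 phi].

Definition primitive_idempotent (V : vectType F) (A : 'End(V) -> Prop)
    (e : 'End(V)) : Prop :=
  [/\ A e, e != 0, (e \o e)%VF = e &
      forall a b : 'End(V), A a -> A b ->
        (a \o a)%VF = a -> (b \o b)%VF = b ->
        (a \o b)%VF = 0 -> (b \o a)%VF = 0 ->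
        e = a + b -> a = 0 \/ b = 0].

End Representations.

Lemma dhomog_vector_axiom (F : fieldType) n d :
  Vector.axiom 'C((d + n).-1, d) (dhomog n F d).
Proof.
case: n => [|n]; last by rewrite addnS; exact: dhomog_vecaxiom.
rewrite addn0; case: d => [|d].
  exists (fun p : dhomog 0 F 0 => const_mx (val p)@_0%MM) => [c p q|].
    by apply/matrixP=> i j; rewrite !mxE /= mcoeffD mcoeffZ.
  have hC (c : F) : c%:MP_[0] \is 0.-homog.
    by rewrite -[_%:MP]mulr1 mul_mpolyC; apply/dhomogZ/dhomog1.
  exists (fun r : 'rV[F]_1 => DHomog (hC (r 0 0))) => [p|r].
    apply/val_inj/mpolyP => m /=; rewrite mxE.
    have -> : m = 0%MM by apply/mnmP; case.
    by rewrite mcoeffC eqxx mulr1.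
  by apply/rowP=> i; rewrite mxE /= mcoeffC eqxx mulr1 ord1.
rewrite bin_small //; exists (fun=> 0) => [c p q|]; first by rewrite scaler0 addr0.
exists (fun=> 0) => [p|r]; last by apply/rowP; case.
apply/val_inj/mpolyP => m /=; rewrite mcoeff0.
apply/esym/(@dhomog_nemf_coeff _ _ mdeg d.+1); first exact: dhomog_is_dhomog.
by rewrite /= mdegE big_ord0.
Qed.

Section Forms.
Variables (F : numFieldType) (V : vectType F).
Local Notation n := (\dim {:V}).

Definition coords (v : V) : 'I_n -> F := fun i => coord (vbasis {:V}) i v.

(* Sym^d(V^* ): the polynomials, homogeneous of degree d, in the coordinates
   of V relative to vbasis {:V}. *)
Definition homform (d : nat) : Type := dhomog n F d.

HB.instance Definition _ d := SubType.on (homform d).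
HB.instance Definition _ d := GRing.Lmodule.on (homform d).
HB.instance Definition _ d :=
  Lmodule_hasFinDim.Build F (homform d) (dhomog_vector_axiom F n d).

Definition form_eval d (f : homform d) (v : V) : F := (val f).@[coords v].

Definition mdirder (v : V) (p : {mpoly F[n]}) : {mpoly F[n]} :=
  \sum_(i < n) coords v i *: p^`M(i).

Lemma mderiv_homog d i (p : {mpoly F[n]}) :
  p \is d.-homog -> p^`M(i) \is d.-1.-homog.
Proof.
move=> /dhomogP hp; rewrite /mderiv big_seq; apply: rpred_sum => m m_p.
case: (posnP (m i)) => [->|m_i]; first by rewrite mul0r scale0r rpred0.
apply: rpredZ; rewrite dhomogX; apply/eqP.
have le_im : (U_(i) <= m)%MM.
  by apply/mnm_lepP => j; rewrite mnm1E; case: eqP => // <-.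
have dE : mdeg m = d := hp m m_p.
have : mdeg (m - U_(i) + U_(i))%MM = d by rewrite submK.
by rewrite mdegD mdeg1 addn1 => <-.
Qed.

Lemma mdirder_homog d v (p : {mpoly F[n]}) :
  p \is d.-homog -> mdirder v p \is d.-1.-homog.
Proof. by move=> hp; apply: rpred_sum => i _; apply/rpredZ/mderiv_homog. Qed.

Definition dirder d (f : homform d) (v : V) : homform d.-1 :=
  DHomog (mdirder_homog v (valP f)).

Lemma coords_linear a u v i :
  coords (a *: u + v) i = a * coords u i + coords v i.
Proof. by rewrite /coords linearP. Qed.

Lemma mdirder_linearl a u v p :
  mdirder (a *: u + v) p = a *: mdirder u p + mdirder v p.
Proof.
rewrite /mdirder scaler_sumr -big_split; apply: eq_bigr => i _ /=.
by rewrite coords_linear scalerDl scalerA.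
Qed.

Lemma mdirder_linearr a v p q :
  mdirder v (a *: p + q) = a *: mdirder v p + mdirder v q.
Proof.
rewrite /mdirder scaler_sumr -big_split; apply: eq_bigr => i _ /=.
by rewrite mderivD mderivZ scalerDr !scalerA mulrC.
Qed.

Lemma dirder_is_linear d (f : homform d) : linear (dirder f).
Proof. by move=> a u v; apply/val_inj/mdirder_linearl. Qed.

HB.instance Definition _ d (f : homform d) :=
  GRing.isLinear.Build F V (homform d.-1) _ (dirder f) (dirder_is_linear f).

(* As D_v f is linear in v, the span of the D_v f is their set. *)
Definition jacobian d (f : homform d) : {vspace homform d.-1} :=
  limg (linfun (dirder f)).

Lemma jacobianP d (f : homform d) (p : homform d.-1) :
  reflect (exists v, p = dirder f v) (p \in jacobian f).
Proof.
apply: (iffP memv_imgP) => [[v _ ->]|[v ->]]; exists v; rewrite ?lfunE //.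
exact: memvf.
Qed.

Definition mlin (X : 'End(V)) : n.-tuple {mpoly F[n]} :=
  [tuple \sum_(j < n) coords (X (vbasis {:V})`_j) i *: 'X_j | i < n].

Lemma mlin_meval X i v : (tnth (mlin X) i).@[coords v] = coords (X v) i.
Proof.
rewrite tnth_mktuple raddf_sum /=.
rewrite {2}(coord_vbasis (memvf v)) linear_sum /coords linear_sum /=.
by apply: eq_bigr => j _; rewrite mevalZ mevalXU !linearZ /= mulrC.
Qed.

Lemma msubst_homog d X (p : {mpoly F[n]}) :
  p \is d.-homog -> p \mPo mlin X \is d.-homog.
Proof.
move=> /dhomogP hp; rewrite comp_mpolyEX big_seq.
apply: rpred_sum => m m_p; apply: rpredZ; rewrite comp_mpolyX.
have /= <- := hp m m_p; rewrite mdegE.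
elim/big_rec2: _ => [|i q k _ hq]; first exact: dhomog1.
apply: dhomogM => //.
suff /(dhomogMn (m i)) : tnth (mlin X) i \is 1.-homog by rewrite mul1n.
rewrite tnth_mktuple; apply: rpred_sum => j _; apply: rpredZ.
by rewrite dhomogX /= mdeg1.
Qed.

Definition form_comp (X : 'End(V)) d (f : homform d) : homform d :=
  DHomog (msubst_homog X (valP f)).

Lemma form_compE X d (f : homform d) v :
  form_eval (form_comp X f) v = form_eval f (X v).
Proof.
rewrite /form_eval comp_mpoly_meval; apply: meval_eq => i.
exact: mlin_meval.
Qed.

Lemma form_comp_is_linear X d : linear (@form_comp X d).
Proof. by move=> a f g; apply: val_inj; rewrite /= comp_mpolyD comp_mpolyZ. Qed.

HB.instance Definition _ X d :=
  GRing.isLinear.Build F (homform d) (homform d) _ (@form_comp X d)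
    (@form_comp_is_linear X d).

Definition form_action (G : groupType) (rho : representation G V) d (g : G) :
    'End(homform d) :=
  linfun (@form_comp (rho g^-1%g) d).

Lemma form_actionE (G : groupType) (rho : representation G V) d g
    (h : homform d) x :
  form_eval (form_action rho d g h) x = form_eval h (rho g^-1%g x).
Proof. by rewrite lfunE form_compE. Qed.

Definition preserves_line (G : groupType) (rho : representation G V)
    (A : {pred G}) d (h : homform d) : Prop :=
  forall g, g \in A -> (form_action rho d g @: <[h]>)%VS = <[h]>%VS.

Definition relative_invariant (G : groupType) (rho : representation G V) d
    (h : homform d) : Prop :=
  h != 0 /\ preserves_line rho predT h.

Definition jacobian_invariant (G : groupType) (rho : representation G V) d
    (f : homform d) : Prop :=
  forall g, (form_action rho d.-1 g @: jacobian f)%VS = jacobian f.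

Definition upd d (v : {ffun 'I_d -> V}) (j : 'I_d) (x : V) :
    {ffun 'I_d -> V} :=
  [ffun i => if i == j then x else v i].

Definition is_polarization d (f : homform d) (Theta : {ffun 'I_d -> V} -> F) :
    Prop :=
  [/\ forall (s : 'S_d) (v : {ffun 'I_d -> V}), Theta [ffun i => v (s i)] = Theta v,
      forall v j a x y, Theta (upd v j (a *: x + y)) =
                        a * Theta (upd v j x) + Theta (upd v j y)
    & forall x, Theta [ffun=> x] = form_eval f x].

Definition mdirders I (v : I -> V) (s : seq I) (p : {mpoly F[n]}) :
    {mpoly F[n]} :=
  foldr (fun i q => mdirder (v i) q) p s.

(* The symmetric d-linear form with Theta_f(x, ..., x) = f(x) (polarP; it is
   unique in characteristic 0), given by
   Theta_f(v_1, ..., v_d) = (D_{v_1} ... D_{v_d} f) / d!, the iterated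
   derivative being a constant polynomial. *)
Definition polar d (f : homform d) (v : {ffun 'I_d -> V}) : F :=
  (d`!)%:R^-1 * (mdirders v (enum 'I_d) (val f))@_0%MM.

Lemma mdirderC u v p : mdirder u (mdirder v p) = mdirder v (mdirder u p).
Proof.
have E x y q : mdirder x (mdirder y q) =
    \sum_(i < n) \sum_(j < n) (coords x i * coords y j) *: q^`M(j)^`M(i).
  rewrite {1}/mdirder; apply: eq_bigr => i _.
  rewrite /mdirder (raddf_sum (mderiv i)) scaler_sumr.
  by apply: eq_bigr => j _ /=; rewrite mderivZ scalerA.
rewrite !E exchange_big; apply: eq_bigr => j _; apply: eq_bigr => i _ /=.
by rewrite mderiv_comm mulrC.
Qed.

Lemma mdirdersC I (v : I -> V) u s p :
  mdirders v s (mdirder u p) = mdirder u (mdirders v s p).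
Proof. by elim: s => //= i s ->; rewrite mdirderC. Qed.

Lemma mdirders_perm (I : eqType) (v : I -> V) s t p :
  perm_eq s t -> mdirders v s p = mdirders v t p.
Proof.
have CC s1 s2 q : mdirders v s1 (mdirders v s2 q) =
                  mdirders v s2 (mdirders v s1 q).
  by elim: s1 => //= i s1 ->; rewrite mdirdersC.
move=> st; apply: (catCA_perm_subst _ st) => {st} s1 s2 s3.
by rewrite /mdirders !foldr_cat; exact: CC.
Qed.

Lemma eq_in_mdirders (I : eqType) (v w : I -> V) s p :
  {in s, v =1 w} -> mdirders v s p = mdirders w s p.
Proof.
elim: s => //= i s IHs vw; rewrite vw ?mem_head // IHs // => j js.
by apply: vw; rewrite inE js orbT.
Qed.

Lemma mdirders_map I J (v : I -> V) (h : J -> I) s p :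
  mdirders v (map h s) p = mdirders (v \o h) s p.
Proof. by elim: s => //= i s ->. Qed.

Lemma mdirder_euler d v (p : {mpoly F[n]}) : p \is d.-homog ->
  (mdirder v p).@[coords v] = d%:R * p.@[coords v].
Proof.
move=> /dhomogP hp; have {2}-> := mpolyE p.
have -> : mdirder v p =
    \sum_(m <- msupp p) \sum_(i < n)
      (p@_m * (m i)%:R * coords v i) *: 'X_[m - U_(i)].
  rewrite exchange_big; apply: eq_bigr => i _ /=.
  rewrite /mderiv scaler_sumr; apply: eq_bigr => m _.
  by rewrite scalerA mulrC [_%:R * _]mulrC.
rewrite !raddf_sum mulr_sumr !big_seq; apply: eq_bigr => m m_p /=.
rewrite mevalZ mulrCA -(hp m m_p) /= mdegE natr_sum mulr_suml mulr_sumr.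
rewrite raddf_sum; apply: eq_bigr => i _ /=.
rewrite mevalZ -!mulrA; congr (_ * _).
case: (posnP (m i)) => [->|m_i]; first by rewrite !mul0r.
congr (_ * _); rewrite -mevalXU -mevalM -mpolyXD addmC submK //.
by apply/mnm_lepP => j; rewrite mnm1E; case: eqP => // <-.
Qed.

Lemma polarP d (f : homform d) : is_polarization f (polar f).
Proof.
split=> [s v|v j a x y|x].
- congr (_ * mcoeff _ _).
  transitivity (mdirders v (map s (enum 'I_d)) (val f)).
    by rewrite (mdirders_map v s); apply: eq_in_mdirders => i _; rewrite ffunE.
  apply: mdirders_perm; apply: uniq_perm; rewrite ?enum_uniq //.
    by rewrite map_inj_uniq ?enum_uniq //; exact: perm_inj.
  move=> i; rewrite mem_enum -(permKV s i); apply: map_f.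
  by rewrite mem_enum.
- have E z : mdirders (upd v j z) (enum 'I_d) (val f) =
             mdirder z (mdirders v (rem j (enum 'I_d)) (val f)).
    have /mdirders_perm -> := perm_to_rem (mem_enum predT j).
    rewrite /= ffunE eqxx; congr mdirder; apply: eq_in_mdirders => i.
    by rewrite mem_rem_uniq ?enum_uniq // !inE ffunE => /andP[/negPf->].
  rewrite /polar !E mdirder_linearl mcoeffD mcoeffZ mulrDr.
  by rewrite mulrCA.
- have hd k (p : {mpoly F[n]}) (s : seq 'I_d) : size s = k ->
      p \is k.-homog ->
      (mdirders (fun=> x) s p)@_0%MM = k`!%:R * p.@[coords x].
    elim: k s p => [|k IHk] [|i s] p //=.
      move=> _ hp; rewrite fact0 mul1r.
      suff {2}-> : p = (p@_0%MM)%:MP by rewrite mevalC.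
      apply/mpolyP => m; rewrite mcoeffC; case: eqVneq => [->|m0].
        by rewrite mulr1.
      rewrite mulr0; apply: (dhomog_nemf_coeff hp).
      by rewrite /= mdeg_eq0.
    move=> [sz] hp; rewrite -mdirdersC (IHk s _ sz (mdirder_homog _ hp)).
    by rewrite (mdirder_euler _ hp) mulrA -natrM mulnC -factS.
  rewrite /polar (@eq_in_mdirders _ _ (fun=> x)) => [|i _]; last by rewrite ffunE.
  rewrite (hd d _ _ (size_enum_ord d) (valP f)) mulrA mulVf ?mul1r //.
  by rewrite pnatr_eq0 -lt0n fact_gt0.
Qed.

(* Apply X to the argument number k, counted from 0. *)
Definition apply_at d (k : nat) (X : 'End(V)) (v : {ffun 'I_d -> V}) :
    {ffun 'I_d -> V} :=
  [ffun i : 'I_d => if i == k :> nat then X (v i) else v i].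

Definition center d (f : homform d) (X : 'End(V)) : Prop :=
  forall v, polar f (apply_at 0 X v) = polar f (apply_at 1 X v).

(* h = f_z, for z in the center of f *)
Definition is_center_twist d (f : homform d) (z : 'End(V)) (h : homform d) :
    Prop :=
  forall v, polar h v = polar f (apply_at 0 z v).

End Forms.

(* Main.v *)
(* Write T for the symmetric map (u, v) |-> D_u D_v f; the center Z of f
   consists of the X with T (X u, v) = T (u, X v). If J(h) = J(f) then
   D_v h = D_(X v) f for a linear X, and the symmetry of second derivatives
   puts X in Z. In particular this applies to h = g . f, whence Z is normalised
   by G, and the irreducibility of V forces the commutative algebra Z to be
   reduced: the common kernel of its square-zero elements is invariant and
   nonzero. Over an algebraically closed field Z is then the span of its
   primitive idempotents e_i, which gives (i). Conjugation by g permutes the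
   e_i, transitively by irreducibility, and g . f_i is a nonzero multiple of
   f_(g i). Parts (ii) and (iii) are read off from this monomial action, after
   identifying J(f) with V through v |-> D_v f. *)
Require Import Defs.
From HB Require Import structures.
From mathcomp Require Import all_boot all_order all_fingroup all_algebra.
From mathcomp Require Import mpoly complex reals boolp spectral.

Set Implicit Arguments.
Unset Strict Implicit.
Unset Printing Implicit Defensive.

Import Order.TTheory GRing.Theory Num.Theory.
Local Open Scope ring_scope.

(** * Derivatives, linear substitutions and polarizations of forms *)

Section Calculus.
Variables (F : numFieldType) (V : vectType F).
Implicit Types (u v x : V) (X Y : 'End(V)).
Local Notation n := (\dim {:V}).

HB.instance Definition _ v :=
  GRing.isLinear.Build F {mpoly F[n]} {mpoly F[n]} _ (mdirder v)
    (fun a => @mdirder_linearr F V a v).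

(** The derivative as a function of the form, with the direction fixed, so that the generic lemmas
    on linear maps also apply in the argument [f]. *)
Definition dirder_at d v (f : homform V d) : homform V d.-1 := dirder f v.

Lemma dirder_at_is_linear d v : linear (@dirder_at d v).
Proof. by move=> a f g; apply/val_inj/mdirder_linearr. Qed.

HB.instance Definition _ d v :=
  GRing.isLinear.Build F (homform V d) (homform V d.-1) _ (@dirder_at d v)
    (@dirder_at_is_linear d v).

Lemma dirderBl d (f g : homform V d) v : dirder (f - g) v = dirder f v - dirder g v.
Proof. exact: (raddfB (dirder_at v)). Qed.

Lemma dirder0l d v : dirder (0 : homform V d) v = 0.
Proof. exact: (raddf0 (dirder_at v)). Qed.

Lemma dirderZl d a (f : homform V d) v : dirder (a *: f) v = a *: dirder f v.
Proof. exact: linearZ_LR (dirder_at v) a f. Qed.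

Lemma dirder_suml d (I : finType) (g : I -> homform V d) v :
  dirder (\sum_i g i) v = \sum_i dirder (g i) v.
Proof. exact: (raddf_sum (dirder_at v)). Qed.

Lemma dirderC d (f : homform V d) u v :
  dirder (dirder f u) v = dirder (dirder f v) u.
Proof. exact/val_inj/mdirderC. Qed.

Lemma coords_basis (i j : 'I_n) : coords (vbasis {:V})`_i j = (i == j)%:R :> F.
Proof. by rewrite /coords coord_free ?(basis_free (vbasisP _)). Qed.

Lemma mdirder_basis (i : 'I_n) (p : {mpoly F[n]}) :
  mdirder (vbasis {:V})`_i p = p^`M(i).
Proof.
rewrite /mdirder (bigD1 i) //= coords_basis eqxx scale1r big1 ?addr0 // => j ji.
by rewrite coords_basis eq_sym (negPf ji) scale0r.
Qed.

(** In positive degree every monomial [m] contains some variable [i], and the coefficient of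
    [m - U_(i)] in the [i]-th partial derivative is that of [m] times a positive integer, invertible
    in characteristic 0. *)
Lemma mdirder_inj d (p : {mpoly F[n]}) : p \is d.+1.-homog ->
  (forall v, mdirder v p = 0) -> p = 0.
Proof.
move=> hp p0; apply/mpolyP => m; rewrite mcoeff0.
have [md|/(dhomog_nemf_coeff hp)->//] := eqVneq (mdeg m) d.+1.
have [i mi] : exists i, (0 < m i)%N.
  apply/existsP; apply: contraPT md => /existsPn m0.
  suff -> : mdeg m = 0%N by [].
  by rewrite mdegE big1 // => i _; have := m0 i; rewrite -eqn0Ngt => /eqP.
have := congr1 (mcoeff (m - U_(i))) (p0 (vbasis {:V})`_i).
rewrite mdirder_basis mcoeff_deriv mcoeff0 submK; last first.
  by apply/mnm_lepP => j; rewrite mnm1E; case: eqP => // <-.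
by move/eqP; rewrite -mulr_natr mulf_eq0 pnatr_eq0 orbF => /eqP.
Qed.

Lemma dirder_inj d (f g : homform V d) : (0 < d)%N ->
  dirder f =1 dirder g -> f = g.
Proof.
case: d f g => // d f g _ fg; apply/eqP; rewrite -subr_eq0; apply/eqP.
apply/val_inj/(mdirder_inj (valP (f - g))) => v.
by have := congr1 val (dirderBl f g v); rewrite fg subrr.
Qed.

Lemma mdirderM v (p q : {mpoly F[n]}) :
  mdirder v (p * q) = mdirder v p * q + p * mdirder v q.
Proof.
rewrite /mdirder mulr_suml mulr_sumr -big_split; apply: eq_bigr => i _ /=.
by rewrite mderivM scalerDr scalerAl scalerAr.
Qed.

Lemma mdirderXU v i : mdirder v 'X_i = (coords v i)%:MP.
Proof.
rewrite /mdirder (bigD1 i) //= big1 ?addr0 => [|j ji].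
  by rewrite mderivX mnm1E eqxx scale1r -{1}[U_(i)%MM]addm0 addmC addmK mpolyX0 -mul_mpolyC mulr1.
by rewrite mderivX mnm1E eq_sym (negPf ji) scale0r scaler0.
Qed.

(** The chain rule for a linear substitution. By linearity it suffices to treat monomials, and the
    Leibniz rule reduces these to single variables. *)
Lemma mdirder_comp X v (p : {mpoly F[n]}) :
  mdirder v (p \mPo mlin X) = mdirder (X v) p \mPo mlin X.
Proof.
have mD1 u : mdirder u 1 = 0 :> {mpoly F[n]}.
  by rewrite /mdirder big1 // => i _; rewrite -mpolyC1 mderivC scaler0.
elim/mpolyind: p => [|c m p _ _ IHp]; first by rewrite !linear0.
rewrite comp_mpolyD comp_mpolyZ !mdirder_linearr IHp comp_mpolyD comp_mpolyZ.
congr (_ *: _ + _); rewrite mpolyXE_id.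
elim/big_rec: _ => [|i q _ IHq]; first by rewrite comp_mpoly1 !mD1 linear0.
rewrite rmorphM !mdirderM rmorphD !rmorphM /= IHq.
congr (_ * _ + _); elim: (m i) => [|k IHk].
  by rewrite !expr0 comp_mpoly1 !mD1 linear0.
rewrite !exprS rmorphM !mdirderM rmorphD !rmorphM /= IHk; congr (_ * _ + _).
rewrite mdirderXU comp_mpolyC comp_mpolyXU -tnth_nth tnth_mktuple.
rewrite (linear_sum (mdirder v)).
rewrite [v in coords (X v)](coord_vbasis (memvf v)) linear_sum /coords linear_sum /=.
rewrite !raddf_sum; apply: eq_bigr => j _ /=.
by rewrite linearZ /= mdirderXU -mul_mpolyC -mpolyCM !linearZ mulrC.
Qed.

Lemma dirder_comp X d (f : homform V d) v :
  dirder (form_comp X f) v = form_comp X (dirder f (X v)).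
Proof. exact/val_inj/mdirder_comp. Qed.

Lemma form_comp1 d (f : homform V d) : form_comp \1%VF f = f.
Proof.
apply: val_inj => /=; rewrite -[RHS]comp_mpoly_id; congr (_ \mPo _).
apply: eq_from_tnth => i; rewrite !tnth_mktuple (bigD1 i) //= lfunE /=.
rewrite coords_basis eqxx scale1r big1 ?addr0 // => j ji.
by rewrite lfunE /= coords_basis (negPf ji) scale0r.
Qed.

Lemma comp_mpolyA m1 m2 m3 (lp : m1.-tuple {mpoly F[m2]})
    (lq : m2.-tuple {mpoly F[m3]}) p :
  (p \mPo lp) \mPo lq = p \mPo [tuple tnth lp i \mPo lq | i < m1].
Proof.
rewrite [p \mPo lp]comp_mpolyEX [RHS]comp_mpolyEX raddf_sum /=.
apply: eq_bigr => m _; rewrite comp_mpolyZ !comp_mpolyX rmorph_prod /=.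
by congr (_ *: _); apply: eq_bigr => i _; rewrite rmorphXn tnth_mktuple.
Qed.

(** Substitution reverses the order of composition; the inverse in [form_action] turns this into a
    left action. *)
Lemma form_compM X Y d (f : homform V d) :
  form_comp (X \o Y)%VF f = form_comp Y (form_comp X f).
Proof.
apply: val_inj; rewrite /= comp_mpolyA; congr (_ \mPo _).
apply: eq_from_tnth => i; rewrite !tnth_mktuple raddf_sum /=.
have E (j : 'I_n) : (coords (X (vbasis {:V})`_j) i *: 'X_j) \mPo mlin Y =
    \sum_(k < n) (coords (X (vbasis {:V})`_j) i * coords (Y (vbasis {:V})`_k) j) *: 'X_k.
  rewrite comp_mpolyZ comp_mpolyXU -(tnth_nth _ (mlin Y)) tnth_mktuple scaler_sumr.
  by apply: eq_bigr => k _; rewrite scalerA.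
rewrite (eq_bigr _ (fun j _ => E j)) {E}.
rewrite exchange_big; apply: eq_bigr => j _ /=; rewrite -scaler_suml.
congr (_ *: _); rewrite comp_lfunE.
rewrite {1}[Y _](coord_vbasis (memvf _)) linear_sum /coords linear_sum /=.
by apply: eq_bigr => k _; rewrite !linearZ /= mulrC.
Qed.

(** One derivative is peeled off at a time by [mdirder_inj]. Since [s] has no repetitions, the
    direction at each index can be chosen freely. *)
Lemma mdirders_homog_inj (I : eqType) (s : seq I) (p : {mpoly F[n]}) :
    p \is (size s).-homog -> uniq s ->
  (forall w : I -> V, (mdirders w s p)@_0%MM = 0) -> p = 0.
Proof.
elim: s p => [|i s IHs] p hp.
  move=> _ /(_ (fun=> 0)) /= p0; apply/mpolyP => m; rewrite mcoeff0.
  have [/eqP|/(dhomog_nemf_coeff hp)->//] := eqVneq (mdeg m) 0%N.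
  by rewrite mdeg_eq0 => /eqP->.
move=> /= /andP[i_s s_uniq] p0; apply: (mdirder_inj hp) => v.
apply: IHs => // [|w]; first exact: (mdirder_homog v hp).
have := p0 (fun j => if j == i then v else w j); rewrite /= eqxx mdirdersC.
rewrite (@eq_in_mdirders _ _ _ _ w) // => j js.
by case: eqP js i_s => // -> ->.
Qed.

Lemma mdirdersB I (w : I -> V) s : {morph mdirders w s : p q / p - q}.
Proof. by move=> p q; elim: s => //= i s ->; rewrite linearB. Qed.

Lemma mdirders_inj (I : eqType) (s : seq I) d (p q : homform V d) :
    size s = d -> uniq s ->
    (forall w : I -> V,
      (mdirders w s (val p))@_0%MM = (mdirders w s (val q))@_0%MM) ->
  p = q.
Proof.
move=> sd s_uniq pq; apply/eqP; rewrite -subr_eq0; apply/eqP/val_inj.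
apply: (mdirders_homog_inj _ s_uniq) => [|w].
  by rewrite sd; exact: (valP (p - q)).
have := mdirdersB w s (val p) (val q) => /(congr1 (mcoeff 0%MM)).
by rewrite mcoeffB pq subrr.
Qed.

Lemma polar_dirder d (f : homform V d.+1) (v : {ffun 'I_d.+1 -> V}) :
  polar f v = d.+1`!%:R^-1 *
    (mdirders v [seq lift ord0 i | i <- enum 'I_d] (val (dirder f (v ord0))))@_0%MM.
Proof. by rewrite /polar enum_ordSl /= mdirdersC. Qed.

Lemma polar_dirder2 d (f : homform V d.+2) (v : {ffun 'I_d.+2 -> V}) :
  polar f v = d.+2`!%:R^-1 *
    (mdirders v [seq lift ord0 (lift ord0 i) | i <- enum 'I_d]
      (val (dirder (dirder f (v ord0)) (v (lift ord0 ord0)))))@_0%MM.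
Proof. by rewrite polar_dirder enum_ordSl /= -map_comp !mdirdersC. Qed.

Lemma fact_inv_neq0 d : d`!%:R^-1 != 0 :> F.
Proof. by rewrite invr_eq0 pnatr_eq0 -lt0n fact_gt0. Qed.

(** Passes from polarizations to first derivatives: slot 0 carries the direction [v], and the other
    slots, being arbitrary, recover the form [dirder h v] by [mdirders_inj]. *)
Lemma is_center_twistP d (f h : homform V d) z : (0 < d)%N ->
  is_center_twist f z h <-> forall v, dirder h v = dirder f (z v).
Proof.
case: d f h => // d f h _; set s := [seq lift ord0 i | i <- enum 'I_d].
have E (v : {ffun 'I_d.+1 -> V}) q :
    mdirders (apply_at 0 z v) s q = mdirders v s q.
  by apply: eq_in_mdirders => _ /mapP[i _ ->]; rewrite ffunE.
split=> hz v; last by rewrite !polar_dirder hz E ffunE.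
apply: (@mdirders_inj _ s) => [||w]; first by rewrite size_map size_enum_ord.
  by rewrite map_inj_uniq ?enum_uniq //; exact: lift_inj.
have := hz [ffun i => if i == ord0 then v else w i].
rewrite !polar_dirder E !ffunE /= => /(mulfI (fact_inv_neq0 _)).
have Ew q : mdirders [ffun i => if i == ord0 then v else w i] s q = mdirders w s q.
  by apply: eq_in_mdirders => _ /mapP[i _ ->]; rewrite ffunE.
by rewrite !Ew.
Qed.

(** The same with two slots set apart: central means self-adjoint for the symmetric map sending [u],
    [v] to the second derivative of [f]. The bound on [d] ensures that slot 1 exists. *)
Lemma centerP d (f : homform V d) X : (1 < d)%N ->
  center f X <->
  forall u v, dirder (dirder f (X u)) v = dirder (dirder f u) (X v).
Proof.
case: d f => [|[|d]] // f _.
set s := [seq lift ord0 (lift ord0 i) | i <- enum 'I_d].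
have E k (v : {ffun 'I_d.+2 -> V}) q : (k < 2)%N ->
    mdirders (apply_at k X v) s q = mdirders v s q.
  by case: k => [|[|]] // _;
     apply: eq_in_mdirders => _ /mapP[i _ ->]; rewrite ffunE.
split=> [hX u v|hX v]; last first.
  rewrite !polar_dirder2 !E // !ffunE.
  by congr (_ * (mdirders _ _ (val _))@_0%MM); exact: hX.
apply: (@mdirders_inj _ s) => [||w]; first by rewrite size_map size_enum_ord.
  by rewrite map_inj_uniq ?enum_uniq // => i j /lift_inj/lift_inj.
pose w' := [ffun i : 'I_d.+2 =>
  if i == ord0 then u else if i == lift ord0 ord0 then v else w i].
have := hX w'.
rewrite !polar_dirder2 !E // !ffunE /= => /(mulfI (fact_inv_neq0 _)).
have Ew q : mdirders w' s q = mdirders w s q.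
  by apply: eq_in_mdirders => _ /mapP[i _ ->]; rewrite ffunE.
by rewrite !Ew.
Qed.
End Calculus.

(** * Subspaces given by a condition, and eigenvectors *)

Lemma vspace_pred (K : fieldType) (V : vectType K) (P : V -> Prop) :
    P 0 -> (forall a u v, P u -> P v -> P (a *: u + v)) ->
  exists U : {vspace V}, forall v, v \in U <-> P v.
Proof.
(* A subspace contained in [P] is enlarged by vectors of [P] outside it until there are none; its
   codimension bounds the number of enlargements. *)
move=> P0 Plin; suff H k (U : {vspace V}) :
    (\dim {:V} - \dim U <= k)%N -> (forall v, v \in U -> P v) ->
    exists U : {vspace V}, forall v, v \in U <-> P v.
  by apply: (H _ 0%VS (leqnn _)) => v; rewrite memv0 => /eqP->.
elim: k U => [|k IHk] U dimU UP;
    (have [[v [Pv vU]]|noV] := pselect (exists v, P v /\ v \notin U); last first).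
- exists U => v; split=> [/UP//|Pv]; apply: contrapT => /negP vU.
  by apply: noV; exists v.
- move: dimU; rewrite leqn0 subn_eq0 => dimU.
  have /eqP UT : U == {:V}%VS by rewrite eqEdim subvf.
  by rewrite UT memvf in vU.
- exists U => v; split=> [/UP//|Pv]; apply: contrapT => /negP vU.
  by apply: noV; exists v.
apply: (IHk (U + <[v]>)%VS).
  have ltU : (\dim U < \dim (U + <[v]>))%N.
    rewrite ltn_neqAle dimvS ?addvSl // andbT.
    rewrite (dimv_leqif_eq (addvSl _ _)).2; apply: contra vU => /eqP->.
    by rewrite (subvP (addvSr _ _)) ?memv_line.
  rewrite -ltnS; apply: leq_trans dimU; apply: ltn_sub2l => //.
  by apply: leq_trans ltU _; rewrite dimvS ?subvf.
move=> _ /memv_addP[u uU [_ /vlineP[a ->] ->]].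
by rewrite addrC; apply: Plin => //; exact: UP.
Qed.

(** Row [i] of [M] holds the coordinates of [T b_i] in a basis of [U], so a row eigenvector of [M]
    lists the coordinates of an eigenvector of [T]. *)
Lemma exists_eigenvector (F : numClosedFieldType) (V : vectType F)
    (T : 'End(V)) (U : {vspace V}) :
    U != 0%VS -> (T @: U <= U)%VS ->
  exists c v, [/\ v \in U, v != 0 & T v = c *: v].
Proof.
move=> U0 TU; pose b := vbasis U; have bU := vbasisP U.
have bi (i : 'I_(\dim U)) : b`_i \in U by rewrite vbasis_mem ?mem_nth ?size_tuple.
pose M : 'M[F]_(\dim U) := \matrix_(i, j) coord b j (T b`_i).
have dimU : (0 < \dim U)%N by rewrite lt0n dimv_eq0.
have [c /eigenvalueP[x xM x0]] := eigenvalue_closed M dimU.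
exists c, (\sum_i x 0 i *: b`_i); split.
- by apply: rpred_sum => i _; exact: rpredZ.
- apply: contra x0 => /eqP xb; apply/eqP/rowP => i; rewrite mxE.
  by move/freeP: (basis_free bU) => /(_ _ xb).
rewrite linear_sum scaler_sumr /=.
transitivity (\sum_j (x *m M) 0 j *: b`_j).
  under eq_bigr => i _.
    rewrite linearZ /= [T _](coord_vbasis (subvP TU _ (memv_img T (bi i)))).
    rewrite scaler_sumr; under eq_bigr do rewrite scalerA.
  over.
  rewrite exchange_big; apply: eq_bigr => j _ /=; rewrite -scaler_suml mxE.
  by congr (_ *: _); apply: eq_bigr => i _; rewrite mxE.
by apply: eq_bigr => j _; rewrite xM mxE scalerA.
Qed.

(** Makes left multiplication by [y] an endomorphism of the space ['End(V)], to which dimension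
    counts apply. *)
Lemma comp_lfun_is_linear (F : fieldType) (V : vectType F) (y : 'End(V)) :
  linear (comp_lfun y : 'End(V) -> 'End(V)).
Proof. by move=> a u v; rewrite comp_lfunDr comp_lfunZr. Qed.

HB.instance Definition _ (F : fieldType) (V : vectType F) (y : 'End(V)) :=
  GRing.isLinear.Build F 'End(V) 'End(V) _ (comp_lfun y : 'End(V) -> 'End(V))
    (comp_lfun_is_linear y).

(** * Reduced commutative algebras of endomorphisms over an algebraically closed field *)

Section ReducedAlgebra.
Variables (F : numClosedFieldType) (V : vectType F) (Z : 'End(V) -> Prop).
Hypothesis Z_linear : forall a x y, Z x -> Z y -> Z (a *: x + y).
Hypothesis Z1 : Z \1%VF.
Hypothesis Z_comp : forall x y, Z x -> Z y -> Z (x \o y)%VF.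
Hypothesis Z_comm : forall x y, Z x -> Z y -> (x \o y = y \o x)%VF.
Hypothesis Z_reduced : forall x, Z x -> (x \o x)%VF = 0 -> x = 0.
Implicit Types x y e : 'End(V).

Lemma Z_zero : Z 0.
Proof. by have := Z_linear (-1) Z1 Z1; rewrite scaleN1r addNr. Qed.

Lemma Z_scale a x : Z x -> Z (a *: x).
Proof. by move=> Zx; rewrite -[_ *: _]addr0; apply: Z_linear => //; exact: Z_zero. Qed.

Lemma Z_add x y : Z x -> Z y -> Z (x + y).
Proof. by move=> Zx Zy; rewrite -[x]scale1r; exact: Z_linear. Qed.

Lemma Z_sub x y : Z x -> Z y -> Z (x - y).
Proof. by move=> Zx Zy; apply: Z_add => //; rewrite -scaleN1r; exact: Z_scale. Qed.

Lemma Z_commE x y v : Z x -> Z y -> x (y v) = y (x v).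
Proof. by move=> Zx Zy; rewrite -!comp_lfunE Z_comm. Qed.

(* Multiplication by y is injective on yZ because Z is reduced, hence maps yZ
   onto itself. *)
Lemma von_neumann_regular y : Z y -> exists2 x, Z x & y = (y \o (y \o x))%VF.
Proof.
move=> Zy; have [A AZ] := vspace_pred Z_zero Z_linear.
pose T : 'End('End(V)) := linfun (comp_lfun y).
have TE x : T x = (y \o x)%VF by rewrite lfunE.
pose I := (T @: A)%VS.
have IA : (I <= A)%VS.
  by apply/subvP => _ /memv_imgP[x /AZ Zx ->]; rewrite TE; apply/AZ/Z_comp.
have TII : (T @: I <= I)%VS by exact: limgS.
have cap0 : (I :&: lker T)%VS = 0%VS.
  apply/eqP; rewrite -subv0; apply/subvP => w.
  rewrite memv_cap memv_ker => /andP[/memv_imgP[x /AZ Zx ->]]; rewrite !TE.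
  move=> /eqP yyx; rewrite memv0; apply/eqP/Z_reduced; first exact: Z_comp.
  by rewrite (Z_comm Zy Zx) -comp_lfunA -(Z_comm Zy Zx) yyx comp_lfun0r.
have TI : (T @: I)%VS = I by apply/eqP; rewrite eqEdim TII (limg_dim_eq cap0) /=.
have : T \1%VF \in I by apply: memv_img; apply/AZ.
rewrite -TI => /memv_imgP[_ /memv_imgP[x /AZ Zx ->]].
by rewrite !TE comp_lfun1r => yE; exists x.
Qed.

Lemma Z_primitive e : primitive_idempotent Z e -> Z e.
Proof. by case. Qed.

Lemma primitiveK e v : primitive_idempotent Z e -> e (e v) = e v.
Proof. by case=> _ _ ee _; rewrite -comp_lfunE ee. Qed.

(** Primitivity is applied to the splitting of [e] into the orthogonal idempotents [e p] and
    [e - e p]. *)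
Lemma primitive_absorb e p : primitive_idempotent Z e -> Z p ->
  (p \o p = p)%VF -> (e \o p = 0 \/ e \o p = e)%VF.
Proof.
move=> prim_e Zp pp; have [Ze _ ee split_e] := prim_e.
have pK v : p (p v) = p v by rewrite -comp_lfunE pp.
have Zep := Z_comp Ze Zp.
have C v : p (e v) = e (p v) := Z_commE v Zp Ze.
case: (split_e (e \o p)%VF (e - (e \o p))%VF) => //.
- exact: Z_sub.
- by apply/lfunP => v; rewrite !lfun_simp C pK (primitiveK _ prim_e).
- apply/lfunP => v; rewrite !lfun_simp ?linearB /= ?C.
  by rewrite !(primitiveK _ prim_e) !pK opprK addNr addr0.
- apply/lfunP => v; rewrite !lfun_simp ?linearB /= ?C.
  by rewrite !(primitiveK _ prim_e) !pK subrr.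
- apply/lfunP => v; rewrite !lfun_simp !C.
  by rewrite !(primitiveK _ prim_e) ?C !pK subrr.
- by rewrite addrC subrK.
- by left.
by move/eqP; rewrite subr_eq0 => /eqP<-; right.
Qed.

Lemma primitive_orth e e' : primitive_idempotent Z e ->
  primitive_idempotent Z e' -> e != e' -> (e \o e')%VF = 0.
Proof.
move=> pe pe' ne; have [Ze _ ee _] := pe; have [Ze' _ ee' _] := pe'.
case: (primitive_absorb pe Ze' ee') => // E.
case: (primitive_absorb pe' Ze ee) => [|E']; first by rewrite Z_comm.
by case/eqP: ne; rewrite -E Z_comm.
Qed.

(** Let [c] be an eigenvalue of [x] on the image of [e], with eigenvector [v], and [y = x e - c e].
    Regularity, [y = y y z], makes [p = y z] an idempotent below [e] with [p y = y]. By primitivity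
    [p] is 0 or [e]; the latter is impossible because [p] kills [v], and the former gives
    [y = 0]. *)
Lemma primitive_scalar e x : primitive_idempotent Z e -> Z x ->
  exists c, (x \o e)%VF = c *: e.
Proof.
move=> pe Zx; have [Ze e0 ee _] := pe.
have eK v := primitiveK v pe.
have [||c [v [/memv_imgP[w _ vE] v0 xv]]] := @exists_eigenvector _ _ x (limg e).
- apply: contra e0 => /eqP e0; apply/eqP/lfunP => v; rewrite lfunE /=.
  by apply/eqP; rewrite -memv0 -e0 memv_img ?memvf.
- apply/subvP => _ /memv_imgP[_ /memv_imgP[v _ ->] ->].
  by rewrite Z_commE // memv_img ?memvf.
exists c; pose y := (x \o e - c *: e)%VF.
have yE u : y u = x (e u) - c *: e u by rewrite !lfun_simp.
have Zy : Z y by apply: Z_sub; [exact: Z_comp | exact: Z_scale].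
have [z Zz yz] := von_neumann_regular Zy.
pose p := (y \o z)%VF; have Zp : Z p := Z_comp Zy Zz.
have py : (p \o y)%VF = y by rewrite Z_comm // -yz.
have pp : (p \o p)%VF = p by rewrite {2}/p comp_lfunA py.
have ey : (e \o y)%VF = y.
  by apply/lfunP => u; rewrite lfunE /= !yE linearB linearZ /= -Z_commE // !eK.
have ep : (e \o p)%VF = p by rewrite /p comp_lfunA ey.
suff y0 : y = 0 by apply/eqP; rewrite -subr_eq0 -/y y0.
have := primitive_absorb pe Zp pp; rewrite ep => -[p0|pE].
  by rewrite -py p0 comp_lfun0l.
have ev : e v = v by rewrite vE eK.
have yv : y v = 0 by rewrite yE ev xv subrr.
have : p v = v by rewrite pE.
rewrite /p Z_comm // comp_lfunE yv linear0 => v00.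
by rewrite -v00 eqxx in v0.
Qed.

(** Descent on the dimension of the image. If [p = a + b] is a proper splitting, the image of [a] is
    strictly smaller: otherwise [b v = a u] for some [u], whence [b v = b (a u) = 0] for every
    [v]. *)
Lemma primitive_below p : Z p -> (p \o p)%VF = p -> p != 0 ->
  exists2 e, primitive_idempotent Z e & (e \o p)%VF = e.
Proof.
have [k] := ubnP (\dim (limg p)); elim: k p => // k IHk p dimp Zp pp p0.
have [[a [b [[Za Zb aa bb] [ab ba pE a0 b0]]]]|no] := pselect (exists a b,
    [/\ Z a, Z b, (a \o a)%VF = a & (b \o b)%VF = b] /\
    [/\ (a \o b)%VF = 0, (b \o a)%VF = 0, p = a + b, a != 0 & b != 0]);
    last first.
  exists p => //; split=> // a b Za Zb aa bb ab ba pE.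
  have [->|a0] := eqVneq a 0; first by left.
  have [->|b0] := eqVneq b 0; first by right.
  by case: no; exists a, b.
have pa : (p \o a)%VF = a by rewrite pE comp_lfunDl ba aa addr0.
have pb : (p \o b)%VF = b by rewrite pE comp_lfunDl ab bb add0r.
have ap : (a \o p)%VF = a by rewrite pE comp_lfunDr ab aa addr0.
have le_ap : (limg a <= limg p)%VS by rewrite -pa limg_comp limgS ?subvf.
have [||||e pe ea] := IHk a => //; last first.
  by exists e => //; rewrite -{1}ea -comp_lfunA ap ea.
rewrite -ltnS; apply: leq_trans dimp; rewrite ltnS ltn_neqAle dimvS // andbT.
rewrite (dimv_leqif_eq le_ap).2; apply: contra b0 => /eqP eq_ap.
apply/eqP/lfunP => v; rewrite lfunE /=.
have : b v \in limg p by rewrite -pb comp_lfunE memv_img ?memvf.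
rewrite -eq_ap => /memv_imgP[u _ bv].
by rewrite -bb comp_lfunE bv -comp_lfunE ba lfunE.
Qed.

Variables (r : nat) (e : 'I_r -> 'End(V)).
Hypothesis e_inj : injective e.
Hypothesis eP : forall x, primitive_idempotent Z x <-> exists i, x = e i.

Lemma e_primitive i : primitive_idempotent Z (e i).
Proof. by apply/eP; exists i. Qed.

Lemma Z_e i : Z (e i).
Proof. exact: Z_primitive (e_primitive i). Qed.

Lemma eE i j v : e i (e j v) = if i == j then e i v else 0.
Proof.
case: eqVneq => [->|ij]; first exact: primitiveK (e_primitive j).
by rewrite -comp_lfunE primitive_orth ?lfunE ?(inj_eq e_inj) //; exact: e_primitive.
Qed.

(** The complement [p] of the sum is an idempotent orthogonal to every [e j]; were it nonzero, some
    primitive idempotent would lie below it. *)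
Lemma e_sum_idem : \sum_i e i = \1%VF.
Proof.
pose p : 'End(V) := (\1 - \sum_i e i)%VF.
have Zp : Z p.
  apply: Z_sub => //; elim/big_ind: _ => [|x y|i _]; [exact: Z_zero|exact: Z_add|].
  exact: Z_e.
have pE v : p v = v - \sum_i e i v by rewrite !lfun_simp.
have ep j : (e j \o p)%VF = 0.
  apply/lfunP => v; rewrite lfunE /= pE linearB linear_sum (bigD1 j) //= big1.
    by rewrite eE eqxx addr0 subrr lfunE.
  by move=> i ij; rewrite eE eq_sym (negPf ij).
have pp : (p \o p)%VF = p.
  apply/lfunP => v; rewrite lfunE /= pE big1 ?subr0 // => i _.
  by rewrite -comp_lfunE ep lfunE.
have [p0|p_neq0] := eqVneq p 0.
  by apply/eqP; rewrite eq_sym -subr_eq0 -/p p0.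
have [_ /eP[j ->]] := primitive_below Zp pp p_neq0.
by rewrite ep => ej0; have [_] := e_primitive j; rewrite -ej0 eqxx.
Qed.

Lemma e_decomp v : v = \sum_i e i v.
Proof. by rewrite -sum_lfunE e_sum_idem lfunE. Qed.

Lemma Z_diagonal x : Z x -> exists c : 'I_r -> F, x = \sum_i c i *: e i.
Proof.
move=> Zx; have /choice[c cP] i := primitive_scalar (e_primitive i) Zx.
exists c; rewrite -[x]comp_lfun1r -e_sum_idem; apply/lfunP => v.
rewrite comp_lfunE !sum_lfunE linear_sum; apply: eq_bigr => i _ /=.
by rewrite -cP comp_lfunE.
Qed.

End ReducedAlgebra.

(** * The center of a form and the forms whose Jacobian is contained in a given one *)

Section Center.
Variables (F : numFieldType) (V : vectType F) (d : nat).
Implicit Types (f h : homform V d) (X Y : 'End(V)).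

Definition nondegenerate_form f := forall v, dirder f v = 0 -> v = 0.

Lemma nondegenerate_inj f u v : nondegenerate_form f ->
  dirder f u = dirder f v -> u = v.
Proof.
by move=> f_nd uv; apply/eqP; rewrite -subr_eq0; apply/eqP/f_nd;
  rewrite linearB /= uv subrr.
Qed.

Hypothesis d_gt1 : (1 < d)%N.

Lemma center_linear f a X Y : center f X -> center f Y -> center f (a *: X + Y).
Proof.
move=> /(centerP _ _ d_gt1) hX /(centerP _ _ d_gt1) hY; apply/centerP => // u v.
rewrite !lfun_simp !linearP /= -hX -hY.
exact: (linearP (dirder_at v) a (dirder f (X u)) (dirder f (Y u))).
Qed.

Lemma center1 f : center f \1%VF.
Proof. by apply/centerP => // u v; rewrite !id_lfunE. Qed.

(** The second derivative of [f] along [X u] and [v] is that of [h] along [u] and [v], which is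
    symmetric. *)
Lemma center_of_twist f h X :
  (forall v, dirder h v = dirder f (X v)) -> center f X.
Proof. by move=> hX; apply/centerP => // u v; rewrite -hX dirderC hX dirderC. Qed.

(** [X] composes the derivative of [h] with a section, over the Jacobian of [f], of the derivative
    of [f]. *)
Lemma jacobian_sub_twist f h : nondegenerate_form f ->
  (jacobian h <= jacobian f)%VS ->
  exists X : 'End(V), forall v, dirder h v = dirder f (X v).
Proof.
move=> f_nd /subvP hf; exists ((linfun (dirder f))^-1 \o linfun (dirder h))%VF => v.
rewrite comp_lfunE [linfun (dirder h) v]lfunE.
have /hf/limg_lfunVK : dirder h v \in jacobian h by apply/jacobianP; exists v.
by rewrite lfunE => ->.
Qed.

Lemma jacobian_twist f h X : lker X == 0%VS ->
  (forall v, dirder h v = dirder f (X v)) -> jacobian h = jacobian f.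
Proof.
move=> X0 hX; apply/vspaceP => p; apply/jacobianP/jacobianP => -[v ->].
  by exists (X v).
by exists (X^-1 v)%VF; rewrite hX lker0_lfunVK.
Qed.

Hypothesis d_gt2 : (2 < d)%N.

(** In a third derivative along [u], [v], [w], both products applied to [u] can be moved away, [X]
    onto [v] and [Y] onto [w], with the same result. This takes three slots, hence [d >= 3]. *)
Lemma center_comm f X Y : nondegenerate_form f -> center f X -> center f Y ->
  (X \o Y = Y \o X)%VF.
Proof.
move=> f_nd /(centerP _ _ d_gt1) hX /(centerP _ _ d_gt1) hY.
apply/lfunP => u; rewrite !comp_lfunE; apply: (nondegenerate_inj f_nd).
apply: dirder_inj => [|v]; first by case: (d) d_gt1 => [|[]].
apply: dirder_inj => [|w]; first by case: (d) d_gt2 => [|[|[]]].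
rewrite hX dirderC hY dirderC.
by rewrite [RHS]dirderC hY [RHS]dirderC hX.
Qed.

Lemma center_comp f X Y : nondegenerate_form f -> center f X -> center f Y ->
  center f (X \o Y)%VF.
Proof.
move=> f_nd cX cY; have XY := center_comm f_nd cX cY.
have /(centerP _ _ d_gt1) hX := cX; have /(centerP _ _ d_gt1) hY := cY.
by apply/centerP => // u v; rewrite {2}XY !comp_lfunE hX hY.
Qed.
End Center.

(** * Conjugation of endomorphisms and irreducibility *)

Section Representation.
Variables (F : fieldType) (G : groupType) (V : vectType F).
Variable rho : representation G V.
Implicit Types (g h : G) (x y : 'End(V)).

Lemma reprM g h v : rho (g * h)%g v = rho g (rho h v).
Proof. by rewrite repr_funM comp_lfunE. Qed.

Lemma repr_funK g : cancel (rho g) (rho g^-1%g).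
Proof. by move=> v; rewrite -reprM mulVg repr_fun1 id_lfunE. Qed.

Lemma repr_funKV g : cancel (rho g^-1%g) (rho g).
Proof. by move=> v; rewrite -reprM mulgV repr_fun1 id_lfunE. Qed.

Lemma repr_eq0 g v : (rho g v == 0) = (v == 0).
Proof.
apply/eqP/eqP => [gv|->]; last exact: linear0.
by rewrite -(repr_funK g v) gv linear0.
Qed.

Lemma limg_repr g : limg (rho g) = fullv.
Proof.
apply/vspaceP => v; rewrite memvf; apply/memv_imgP.
by exists (rho g^-1%g v); rewrite ?memvf ?repr_funKV.
Qed.

Definition conj_end g x : 'End(V) := (rho g \o x \o rho g^-1%g)%VF.

Lemma conj_endE g x v : conj_end g x v = rho g (x (rho g^-1%g v)).
Proof. by rewrite !comp_lfunE. Qed.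

Lemma conj_endD g : {morph conj_end g : x y / x + y}.
Proof. by move=> x y; rewrite /conj_end comp_lfunDr comp_lfunDl. Qed.

Lemma conj_end_comp g : {morph conj_end g : x y / (x \o y)%VF}.
Proof. by move=> x y; apply/lfunP => v; rewrite !(comp_lfunE, conj_endE) repr_funK. Qed.

Lemma conj_end0 g : conj_end g 0 = 0.
Proof. by rewrite /conj_end comp_lfun0r comp_lfun0l. Qed.

Lemma conj_endM g h x : conj_end (g * h)%g x = conj_end g (conj_end h x).
Proof.
by apply/lfunP => v; rewrite !conj_endE invMg !reprM.
Qed.

Lemma conj_end1 x : conj_end 1%g x = x.
Proof. by apply/lfunP => v; rewrite conj_endE invg1 !repr_fun1 !id_lfunE. Qed.

Lemma conj_endK g : cancel (conj_end g) (conj_end g^-1%g).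
Proof. by move=> x; rewrite -conj_endM mulVg conj_end1. Qed.

Lemma conj_endKV g : cancel (conj_end g^-1%g) (conj_end g).
Proof. by move=> x; rewrite -conj_endM mulgV conj_end1. Qed.

Lemma primitive_conj (Z : 'End(V) -> Prop) g x :
    (forall h y, Z y -> Z (conj_end h y)) ->
  primitive_idempotent Z x -> primitive_idempotent Z (conj_end g x).
Proof.
move=> Z_conj [Zx x0 xx x_split]; split.
- exact: Z_conj.
- by apply: contra x0 => /eqP gx; rewrite -(conj_endK g x) gx conj_end0.
- by rewrite -conj_end_comp xx.
move=> a b Za Zb aa bb ab ba gx.
have [||||||| a0|b0] := x_split (conj_end g^-1%g a) (conj_end g^-1%g b).
- exact: Z_conj.
- exact: Z_conj.
- by rewrite -conj_end_comp aa.
- by rewrite -conj_end_comp bb.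
- by rewrite -conj_end_comp ab conj_end0.
- by rewrite -conj_end_comp ba conj_end0.
- by rewrite -conj_endD -gx conj_endK.
- by left; rewrite -(conj_endKV g a) a0 conj_end0.
- by right; rewrite -(conj_endKV g b) b0 conj_end0.
Qed.

(** Irreducibility for a subspace given by a condition, so that its uses need not build the
    invariant subspace. *)
Lemma irreducible_pred (P : V -> Prop) : irreducible rho ->
    P 0 -> (forall a u v, P u -> P v -> P (a *: u + v)) ->
    (forall g v, P v -> P (rho g v)) -> (exists2 v, v != 0 & P v) ->
  forall v, P v.
Proof.
move=> [_ irr] P0 Plin PG [v0 v0_neq0 Pv0] v; have [U UP] := vspace_pred P0 Plin.
have [g|U0|UT] := irr U.
- by apply/subvP => _ /memv_imgP[u /UP Pu ->]; apply/UP/PG.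
- by move/UP: Pv0; rewrite U0 memv0 (negPf v0_neq0).
- by apply/UP; rewrite UT memvf.
Qed.

(* The common kernel of the square-zero elements of Z is invariant, and it is
   nonzero because these elements commute. *)
Lemma irreducible_reduced (Z : 'End(V) -> Prop) : irreducible rho ->
    (forall g x, Z x -> Z (conj_end g x)) ->
    (forall x y, Z x -> Z y -> (x \o y = y \o x)%VF) ->
  forall x, Z x -> (x \o x)%VF = 0 -> x = 0.
Proof.
move=> irr Z_conj Z_comm; have [V0 _] := irr; pose N x := Z x /\ (x \o x)%VF = 0.
suff K v : forall x, N x -> x v = 0.
  by move=> x Zx xx; apply/lfunP => v; rewrite lfunE; exact: K.
move: v; apply: irreducible_pred irr _ _ _ _ => [x _|a u v hu hv x Nx|g v hv x [Zx xx]|].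
- exact: linear0.
- by rewrite linearP /= hu // hv // scaler0 addr0.
- have : conj_end g^-1%g x v = 0.
    by apply: hv; split; [exact: Z_conj | rewrite -conj_end_comp xx conj_end0].
  by rewrite conj_endE invgK => /eqP; rewrite repr_eq0 => /eqP.
(* Descent from [V] through nonzero subspaces stable under all square-zero elements. If some such
   [x] does not kill [U], pass to [x U]: it is stable by commutativity, and smaller because [x]
   kills it but not [U]. At the end all of [U] is killed. *)
have K (U : {vspace V}) : U != 0%VS -> (forall x, N x -> (x @: U <= U)%VS) ->
    exists2 v, v != 0 & forall x, N x -> x v = 0.
  have [k] := ubnP (\dim U); elim: k U => // k IHk U dimU U0 NU.
  have [[x [Nx xU]]|no] := pselect (exists x, N x /\ (x @: U)%VS != 0%VS).
    apply: (IHk (x @: U)%VS) => //.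
      rewrite -ltnS; apply: leq_trans dimU.
      rewrite ltnS ltn_neqAle dimvS ?NU // andbT (dimv_leqif_eq (NU x Nx)).2.
      apply: contra xU => /eqP xU; rewrite -{1}xU -limg_comp Nx.2.
      by rewrite -subv0; apply/subvP => _ /memv_imgP[v _ ->]; rewrite lfunE mem0v.
    move=> y Ny; rewrite -limg_comp Z_comm; [|exact: Ny.1|exact: Nx.1].
    by rewrite limg_comp limgS ?NU.
  exists (vpick U) => [|x Nx]; first by rewrite vpick0.
  apply/eqP/negPn/negP => xv; apply: no; exists x; split=> //.
  apply: contra xv => /eqP xU; rewrite -memv0 -xU memv_img ?memv_pick //.
by apply: (K {:V}%VS) => [|x _]; [exact: V0 | exact: subvf].
Qed.
End Representation.

(** * The action of the group on forms and on Jacobians *)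

Section FormAction.
Variables (F : numFieldType) (G : groupType) (V : vectType F).
Variable rho : representation G V.
Implicit Types (g h : G) (v : V).

Lemma form_action_dirder d (f : homform V d) g v :
  form_action rho d.-1 g (dirder f v) = dirder (form_action rho d g f) (rho g v).
Proof. by rewrite !lfunE /= dirder_comp repr_funK. Qed.

Lemma form_action1 d (f : homform V d) : form_action rho d 1%g f = f.
Proof. by rewrite lfunE /= invg1 repr_fun1 form_comp1. Qed.

Lemma form_actionM d (f : homform V d) g h :
  form_action rho d (g * h)%g f = form_action rho d g (form_action rho d h f).
Proof. by rewrite !lfunE /= invMg repr_funM form_compM. Qed.

Lemma form_actionK d g :
  cancel (form_action rho d g) (form_action rho d g^-1%g).
Proof. by move=> f; rewrite -form_actionM mulVg form_action1. Qed.

Lemma form_action_eq0 d g (f : homform V d) :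
  (form_action rho d g f == 0) = (f == 0).
Proof.
apply/eqP/eqP => [gf|->]; last exact: linear0.
by rewrite -(form_actionK g f) gf linear0.
Qed.

Lemma jacobian_action d (f : homform V d) g :
  jacobian (form_action rho d g f) = (form_action rho d.-1 g @: jacobian f)%VS.
Proof.
apply/vspaceP => p; apply/jacobianP/memv_imgP => [[v ->]|[_ /jacobianP[v ->] ->]].
  exists (dirder f (rho g^-1%g v)); first by apply/jacobianP; exists (rho g^-1%g v).
  by rewrite form_action_dirder repr_funKV.
by exists (rho g v); rewrite form_action_dirder.
Qed.

(** The directions that kill [f] are exactly those that kill every element of its Jacobian, by
    symmetry of second derivatives; so they form an invariant subspace. It cannot be all of [V],
    since [f] would then vanish. *)
Lemma jacobian_invariant_nondegenerate d (f : homform V d) :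
    irreducible rho -> (1 < d)%N -> f != 0 -> jacobian_invariant rho f ->
  nondegenerate_form f.
Proof.
move=> irr d_gt1 f0 Jf.
have d_gt0 : (0 < d)%N by exact: ltnW.
have ker_annihilator v :
    dirder f v = 0 <-> forall p, p \in jacobian f -> dirder p v = 0.
  split=> [fv _ /jacobianP[u ->]|fv]; first by rewrite dirderC fv dirder0l.
  apply: dirder_inj => [|u]; first by case: (d) d_gt1 => [|[]].
  by rewrite dirderC dirder0l fv //; apply/jacobianP; exists u.
suff no_ker : ~ exists2 v, v != 0 & dirder f v = 0.
  by move=> v fv; apply/eqP/negPn/negP => v0; apply: no_ker; exists v.
move=> ker; case/eqP: f0; apply: dirder_inj => // v; rewrite dirder0l; move: v.
apply: irreducible_pred irr _ _ _ ker => [|a u v fu fv|g v fv].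
- exact: linear0.
- by rewrite linearP /= fu fv scaler0 addr0.
apply/ker_annihilator => p; rewrite -(Jf g) => /memv_imgP[q qJ ->].
by rewrite -form_action_dirder (ker_annihilator v).1 // linear0.
Qed.
End FormAction.

(** * Forms with invariant Jacobian: the center and the forms with the same Jacobian *)

Section InvariantJacobian.
Variables (F : numClosedFieldType) (G : groupType) (V : vectType F).
Variables (rho : representation G V) (d : nat) (f : homform V d).
Hypothesis irr : irreducible rho.
Hypothesis d_gt2 : (2 < d)%N.
Hypothesis f_neq0 : f != 0.
Hypothesis Jf : jacobian_invariant rho f.
Implicit Types (g h : G) (u v : V) (x y : 'End(V)).

Local Notation act := (form_action rho d).
Local Notation act1 := (form_action rho d.-1).

Let d_gt1 : (1 < d)%N. Proof. exact: ltnW. Qed.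
Let d_gt0 : (0 < d)%N. Proof. exact: ltnW. Qed.
Let f_nd : nondegenerate_form f.
Proof. exact: jacobian_invariant_nondegenerate irr d_gt1 f_neq0 Jf. Qed.

Lemma action_twist_exists g :
  exists z : 'End(V), forall v, dirder (act g f) v = dirder f (z v).
Proof. by apply: jacobian_sub_twist => //; rewrite jacobian_action Jf. Qed.

(** Acting by [g^-1] turns second derivatives of [f] into those of [g^-1 . f], which is [f] twisted
    by a central [z]. As [z] commutes with [x], the self-adjointness of [x] gives that of its
    conjugate. *)
Lemma center_conj g x : center f x -> center f (conj_end rho g x).
Proof.
move=> cx; have [z zP] := action_twist_exists g^-1%g.
have xz := center_comm d_gt1 d_gt2 f_nd cx (center_of_twist d_gt1 zP).
have /(centerP _ _ d_gt1) hx := cx; apply/centerP => // u v.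
have inj (p q : homform V d.-1.-1) :
    form_action rho d.-1.-1 g^-1%g p = form_action rho d.-1.-1 g^-1%g q -> p = q.
  by move/(congr1 (form_action rho d.-1.-1 g)); rewrite -!form_actionM mulgV !form_action1.
apply: inj; rewrite !form_action_dirder !zP !conj_endE !repr_funK.
by rewrite -[z (x _)]comp_lfunE -xz comp_lfunE hx.
Qed.

Lemma center_reduced x : center f x -> (x \o x)%VF = 0 -> x = 0.
Proof.
apply: irreducible_reduced irr center_conj _ _ => y z cy cz.
exact: center_comm f_nd cy cz.
Qed.

Variables (r : nat) (e : 'I_r -> 'End(V)) (fi : 'I_r -> homform V d).
Hypothesis e_inj : injective e.
Hypothesis eP : forall x, primitive_idempotent (center f) x <-> exists i, x = e i.
Hypothesis fiP : forall i, is_center_twist f (e i) (fi i).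

Let c_lin := fun a x y => @center_linear F V d d_gt1 f a x y.
Let c_one := center1 d_gt1 f.
Let c_comp := fun x y => @center_comp F V d d_gt1 d_gt2 f x y f_nd.
Let c_comm := fun x y => @center_comm F V d d_gt1 d_gt2 f x y f_nd.

Lemma center_diagonal x : center f x -> exists c : 'I_r -> F, x = \sum_i c i *: e i.
Proof. exact: (Z_diagonal c_lin c_one c_comp c_comm center_reduced e_inj eP). Qed.

Lemma idem_decomp v : v = \sum_i e i v.
Proof. exact: (e_decomp c_lin c_one c_comp c_comm e_inj eP). Qed.

Lemma idemE i j v : e i (e j v) = if i == j then e i v else 0.
Proof. exact: (eE c_lin c_one c_comp c_comm e_inj eP). Qed.

Lemma idem_sumE j (w : 'I_r -> V) : e j (\sum_i e i (w i)) = e j (w j).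
Proof.
rewrite linear_sum (bigD1 j) //= idemE eqxx big1 ?addr0 // => i ij.
by rewrite idemE eq_sym (negPf ij).
Qed.

Lemma idem_neq0 i : exists v, e i v != 0.
Proof.
have [_ ei0 _ _] := (eP (e i)).2 (ex_intro _ i erefl).
apply: contrapT => no; case/eqP: ei0; apply/lfunP => v; rewrite lfunE.
by apply/eqP/negPn/negP => ev; apply: no; exists v.
Qed.

Lemma dirder_fi i v : dirder (fi i) v = dirder f (e i v).
Proof. exact: (is_center_twistP f (fi i) (e i) d_gt0).1. Qed.

Lemma fi_neq0 i : fi i != 0.
Proof.
have [v ev] := idem_neq0 i; apply: contra ev => /eqP fi0.
by apply/eqP/f_nd; rewrite -dirder_fi fi0 dirder0l.
Qed.

Lemma dirder_sum_fi (c : 'I_r -> F) v :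
  dirder (\sum_i c i *: fi i) v = dirder f (\sum_i c i *: e i v).
Proof.
rewrite dirder_suml linear_sum; apply: eq_bigr => i _ /=.
by rewrite dirderZl dirder_fi linearZ.
Qed.

(** This form is [f] twisted by the combination [X] of the idempotents, and [X] is injective because
    it scales each block by a nonzero constant. *)
Lemma jacobian_sum_fi (c : 'I_r -> F) : (forall i, c i != 0) ->
  jacobian (\sum_i c i *: fi i) = jacobian f.
Proof.
move=> c0; pose X : 'End(V) := \sum_i c i *: e i.
have XE v : X v = \sum_i c i *: e i v.
  by rewrite sum_lfunE; apply: eq_bigr => i _; rewrite scale_lfunE.
apply: (@jacobian_twist _ _ _ _ _ X) => [|v]; last by rewrite dirder_sum_fi XE.
rewrite -subv0; apply/subvP => v; rewrite memv_ker memv0 => /eqP Xv0.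
rewrite [v]idem_decomp big1 // => j _; apply/eqP.
have : e j (X v) = 0 by rewrite Xv0 linear0.
rewrite XE; under eq_bigr do rewrite -linearZ.
by rewrite idem_sumE linearZ => /eqP; rewrite scaler_eq0 (negPf (c0 j)).
Qed.

Lemma jacobian_eqP (h : homform V d) : jacobian h = jacobian f <->
  exists c : 'I_r -> F, (forall i, c i != 0) /\ h = \sum_i c i *: fi i.
Proof.
split=> [hJ|[c [c0 ->]]]; last exact: jacobian_sum_fi.
have [|X hX] := jacobian_sub_twist f_nd (_ : jacobian h <= jacobian f)%VS.
  by rewrite hJ subvv.
have [c XE] := center_diagonal (center_of_twist d_gt1 hX).
have hE : h = \sum_i c i *: fi i.
  apply: dirder_inj => // v; rewrite dirder_sum_fi hX XE sum_lfunE.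
  by congr (dirder f _); apply: eq_bigr => i _; rewrite scale_lfunE.
exists c; split=> // i; have [v ev] := idem_neq0 i.
apply: contra ev => /eqP ci0; apply/eqP.
(* If [c i] vanished, [X] would have no component in block [i], and the derivative of [f] along
   [e i v] could not lie in the Jacobian of [h]. *)
have /jacobianP[u] : dirder f (e i v) \in jacobian h.
  by rewrite hJ; apply/jacobianP; exists (e i v).
rewrite hX => /(nondegenerate_inj f_nd) ev.
have -> : e i v = e i (e i v) by rewrite idemE eqxx.
rewrite ev XE sum_lfunE; under eq_bigr do rewrite scale_lfunE -linearZ.
by rewrite idem_sumE ci0 scale0r linear0.
Qed.


(** * The permutation of the blocks *)

Lemma conj_idem g i : exists j, conj_end rho g (e i) = e j.
Proof.
have [|j ->] := (eP (conj_end rho g (e i))).1; last by exists j.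
by apply: primitive_conj center_conj _; apply/eP; exists i.
Qed.

(** The permutation of block indices induced by [g]; the index is unique since [e] is injective. *)
Definition sg g i : 'I_r := projT1 (cid (conj_idem g i)).

Lemma conj_sg g i : conj_end rho g (e i) = e (sg g i).
Proof. by rewrite /sg; case: cid. Qed.

Lemma sgM g h i : sg (g * h)%g i = sg g (sg h i).
Proof. by apply: e_inj; rewrite -!conj_sg conj_endM. Qed.

Lemma sg1 i : sg 1%g i = i.
Proof. by apply: e_inj; rewrite -conj_sg conj_end1. Qed.

Lemma sgK g : cancel (sg g) (sg g^-1%g).
Proof. by move=> i; rewrite -sgM mulVg sg1. Qed.

Lemma sgKV g : cancel (sg g^-1%g) (sg g).
Proof. by move=> i; rewrite -sgM mulgV sg1. Qed.

Lemma repr_idem g i v : rho g (e i v) = e (sg g i) (rho g v).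
Proof. by rewrite -conj_sg conj_endE repr_funK. Qed.

Lemma limg_idem_inj i j : limg (e i) = limg (e j) -> i = j.
Proof.
move=> ij; apply/eqP/negPn/negP => neq_ij; have [v /eqP[]] := idem_neq0 i.
have : e i v \in limg (e j) by rewrite -ij memv_img ?memvf.
move=> /memv_imgP[u _ ev]; have -> : e i v = e i (e i v) by rewrite idemE eqxx.
by rewrite ev idemE (negPf neq_ij).
Qed.

Lemma stabilizer_idemP g i : (g \in set_stabilizer rho (limg (e i))) = (sg g i == i).
Proof.
rewrite inE -limg_comp.
have -> : (rho g \o e i = e (sg g i) \o rho g)%VF.
  by apply/lfunP => v; rewrite !comp_lfunE repr_idem.
rewrite limg_comp limg_repr; apply/eqP/eqP => [/limg_idem_inj//|-> //].
Qed.

Lemma sg_transitive i j : exists g, sg g i = j.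
Proof.
apply: contrapT => no_g; have [v ev] := idem_neq0 j.
(* [P] describes the sum of the blocks in the orbit of [i]: all components outside the orbit
   vanish. *)
pose P v := forall j, (forall g, sg g i <> j) -> e j v = 0.
suff PT : forall v, P v.
  by case/eqP: ev; apply: PT => g gij; apply: no_g; exists g.
apply: irreducible_pred irr _ _ _ _ => [k _|a u w Pu Pw k hk|g w Pw k hk|].
- exact: linear0.
- by rewrite linearP /= Pu // Pw // scaler0 addr0.
- rewrite -(sgKV g k) -repr_idem Pw ?linear0 // => h hi.
  by apply: (hk (g * h)%g); rewrite sgM hi sgKV.
have [w ew] := idem_neq0 i; exists (e i w) => // k hk.
by rewrite idemE; case: eqVneq => // ki; case: (hk 1%g); rewrite sg1 ki.
Qed.

(** * The monomial action on the block forms *)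

(* [twist g] is the z in the center of f such that g . f = f_z. *)
Definition twist g : 'End(V) := projT1 (cid (action_twist_exists g)).

Lemma twistP g v : dirder (act g f) v = dirder f (twist g v).
Proof. by rewrite /twist; case: cid. Qed.

Lemma twist_center g : center f (twist g).
Proof. by apply: (center_of_twist d_gt1 (h := act g f)) => v; exact: twistP. Qed.

(** The scalars by which the twist of [g] acts on the blocks; they are the entries of the monomial
    matrix of [g] in [action_fi]. *)
Definition coef g : 'I_r -> F := projT1 (cid (center_diagonal (twist_center g))).

Lemma twistE g : twist g = \sum_i coef g i *: e i.
Proof. by rewrite /coef; case: cid. Qed.

Lemma idem_twist g i v : e i (twist g v) = coef g i *: e i v.
Proof.
rewrite twistE sum_lfunE; under eq_bigr do rewrite scale_lfunE -linearZ.
by rewrite idem_sumE linearZ.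
Qed.

Lemma twist_idem g i v : twist g (e i v) = coef g i *: e i v.
Proof.
rewrite twistE sum_lfunE (bigD1 i) //= scale_lfunE idemE eqxx big1 ?addr0 //.
by move=> j ji; rewrite scale_lfunE idemE (negPf ji) scaler0.
Qed.

(** With [j = sg g i], the derivative of [g . f_i] along [v] is that of [g . f] along [e j v], and
    on block [j] the twist of [g] is the scalar [coef g j]. *)
Lemma action_fi g i : act g (fi i) = coef g (sg g i) *: fi (sg g i).
Proof.
apply: dirder_inj => // v; rewrite -{1}(repr_funKV rho g v) -form_action_dirder.
rewrite dirder_fi form_action_dirder repr_idem repr_funKV twistP twist_idem.
by rewrite linearZ dirderZl dirder_fi.
Qed.

Lemma coef_neq0 g i : coef g i != 0.
Proof.
have := fi_neq0 (sg g^-1%g i); rewrite -(form_action_eq0 rho g) action_fi sgKV.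
by rewrite scaler_eq0 negb_or => /andP[].
Qed.

(* The action of G on V obtained by transporting its action on the Jacobian
   along v |-> D_v f. *)
Definition jac_repr g : 'End(V) := (twist g \o rho g)%VF.

Lemma jac_reprP g v : act1 g (dirder f v) = dirder f (jac_repr g v).
Proof. by rewrite form_action_dirder twistP comp_lfunE. Qed.

Lemma jac_reprM g h v : jac_repr (g * h)%g v = jac_repr g (jac_repr h v).
Proof.
by apply: (nondegenerate_inj f_nd); rewrite -!jac_reprP form_actionM.
Qed.

Lemma idem_jac_repr g i v :
  e (sg g i) (jac_repr g v) = coef g (sg g i) *: rho g (e i v).
Proof. by rewrite comp_lfunE idem_twist repr_idem. Qed.

(** Inverse of the identification of [V] with the Jacobian; meaningful only on the Jacobian. *)
Definition jac_vec (p : homform V d.-1) : V := (linfun (dirder f))^-1%VF p.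

Lemma jac_vecP p : p \in jacobian f -> dirder f (jac_vec p) = p.
Proof. by move/limg_lfunVK; rewrite lfunE. Qed.

Lemma jac_vecK v : jac_vec (dirder f v) = v.
Proof.
by apply: (nondegenerate_inj f_nd); rewrite jac_vecP //; apply/jacobianP; exists v.
Qed.

Lemma jac_vec_action g p : p \in jacobian f ->
  jac_vec (act1 g p) = jac_repr g (jac_vec p).
Proof. by move=> pJ; rewrite -{1}(jac_vecP pJ) jac_reprP jac_vecK. Qed.

Lemma act_jacobian g p : p \in jacobian f -> act1 g p \in jacobian f.
Proof. by move=> pJ; rewrite -(Jf g) memv_img. Qed.

(** * The stabilizer of a block and its character *)

Variables (i1 : 'I_r) (psi : G -> F).
Let W := limg (e i1).
Let K := set_stabilizer rho W.
Hypothesis psiP : forall k, k \in K -> act k (fi i1) = psi k *: fi i1.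

Lemma stabilizerP g : (g \in K) = (sg g i1 == i1).
Proof. exact: stabilizer_idemP. Qed.

Lemma psi_coef k : k \in K -> psi k = coef k i1.
Proof.
move=> kK; have := psiP kK; move: kK; rewrite stabilizerP action_fi => /eqP->.
move/eqP; rewrite -subr_eq0 -scalerBl scaler_eq0 (negPf (fi_neq0 i1)) orbF subr_eq0.
by move/eqP.
Qed.

Lemma stabilizer_preserves_line : preserves_line rho K (fi i1).
Proof.
move=> k; rewrite stabilizerP limg_line action_fi => /eqP->.
by apply/eqP; rewrite eqEsubv -!memvE !memvZ ?memv_line //=;
  apply/vlineP; exists (coef k i1)^-1; rewrite scalerA mulVf ?coef_neq0 ?scale1r.
Qed.

Lemma psi_linear_character : linear_character K psi.
Proof.
split=> [k kK|g h gK hK]; first by rewrite psi_coef ?coef_neq0.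
have ghK : (g * h)%g \in K.
  by move: gK hK; rewrite !stabilizerP sgM => /eqP gi /eqP->; rewrite gi.
apply/eqP; rewrite -subr_eq0.
have : psi (g * h)%g *: fi i1 = (psi g * psi h) *: fi i1.
  by rewrite -psiP // form_actionM psiP // linearZ /= psiP // scalerA mulrC.
move/eqP; rewrite -subr_eq0 -scalerBl scaler_eq0 (negPf (fi_neq0 i1)) orbF.
by [].
Qed.

(** * The Jacobian as an induced module *)

(* Under D_w f <-> w the module J(f) becomes V with the action [jac_repr], and
   g^-1 . D_w f is mapped to the W-component of [jac_repr g^-1 w]. *)
Definition ind_map (p : subvs_of (jacobian f)) g : subvs_of W :=
  vsproj W (e i1 (jac_repr g^-1%g (jac_vec (vsval p)))).

Lemma ind_map_linear a p q g :
  ind_map (a *: p + q) g = a *: ind_map p g + ind_map q g.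
Proof. by rewrite /ind_map /jac_vec !linearP. Qed.

Lemma ind_map_action h p g :
  ind_map (sub_action act1 h p) g = ind_map p (h^-1 * g)%g.
Proof.
rewrite /ind_map /sub_action vsprojK ?act_jacobian ?subvsP // jac_vec_action ?subvsP //.
by rewrite -jac_reprM invMg invgK.
Qed.

(** The value at [g] determines the component in block [sg g i1], and transitivity reaches every
    block. *)
Lemma ind_map_inj p q : ind_map p =1 ind_map q -> p = q.
Proof.
move=> pq; apply: val_inj => /=.
rewrite -(jac_vecP (subvsP p)) -(jac_vecP (subvsP q)); congr (dirder f _).
rewrite [jac_vec _]idem_decomp [RHS]idem_decomp; apply: eq_bigr => j _.
have [g gj] := sg_transitive i1 j; have gj1 : sg g^-1%g j = i1 by rewrite -gj sgK.
have := congr1 vsval (pq g); rewrite /ind_map !vsprojK ?memv_img ?memvf //.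
rewrite -gj1 !idem_jac_repr gj1 => /(scalerI (coef_neq0 _ _)).
exact: (can_inj (repr_funK rho _)).
Qed.

Lemma twist_sub_actionE k (w : subvs_of W) : k \in K ->
  vsval (twist_action psi (sub_action rho (U := W)) k w) = psi k *: rho k (vsval w).
Proof.
move=> kK; rewrite /twist_action linearZ /= /sub_action vsprojK //.
have /eqP kW : (rho k @: W)%VS == W := kK.
by have := memv_img (rho k) (subvsP w); rewrite kW.
Qed.

Lemma stabilizerV k : k \in K -> k^-1%g \in K.
Proof. by rewrite !stabilizerP => /eqP ki; rewrite -{1}ki sgK. Qed.

(** The source of the twist by [psi]: into [W], the transported action of [k^-1] differs from
    [rho k^-1] by the factor [coef k^-1 i1], which is [psi k^-1]. *)
Lemma ind_map_equivariant p g k : k \in K ->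
  ind_map p (g * k)%g =
  twist_action psi (sub_action rho (U := W)) k^-1%g (ind_map p g).
Proof.
move=> /stabilizerV kK; apply: subvs_inj; rewrite twist_sub_actionE // psi_coef //.
rewrite /ind_map !vsprojK ?memv_img ?memvf // invMg jac_reprM.
have /eqP ki : sg k^-1%g i1 == i1 by rewrite -stabilizerP.
by rewrite -{1}ki idem_jac_repr ki.
Qed.

Lemma jacobian_iso_Ind :
  iso_Ind K (sub_action act1 (U := jacobian f))
    (twist_action psi (sub_action rho (U := W))).
Proof.
exists ind_map; split; [exact: ind_map_linear | exact: ind_map_action |
  exact: ind_map_inj | move=> phi].
have [t tP] := choice (sg_transitive i1).
have coset g : ((t (sg g i1))^-1 * g)%g \in K.
  by rewrite stabilizerP sgM; move: (sg g i1) => j; rewrite -{2}(tP j) sgK.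
split=> [[phiK _]|[p phiE]]; last first.
  split=> [g k kK|]; first by rewrite -!phiE ind_map_equivariant.
  (* The finitely many [t j] represent all left cosets, so the support condition always holds. *)
  by exists (codom t) => g _; exists (t (sg g i1)); rewrite ?codom_f.
(* The component in block [j] is found by solving for the prescribed value at [t j], that is, by
   undoing the factor [coef] and the action of the inverse of [t j]. *)
pose w := \sum_j e j ((coef (t j)^-1%g i1)^-1 *: rho (t j) (vsval (phi (t j)))).
have wJ : dirder f w \in jacobian f by apply/jacobianP; exists w.
exists (vsproj (jacobian f) (dirder f w)).
have Et j : ind_map (vsproj (jacobian f) (dirder f w)) (t j) = phi (t j).
  have tj : sg (t j)^-1%g j = i1 by rewrite -{2}(tP j) sgK.
  apply: subvs_inj; rewrite /ind_map !vsprojK ?memv_img ?memvf // jac_vecK.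
  rewrite -tj idem_jac_repr tj /w idem_sumE repr_idem tj !linearZ /= repr_funK.
  rewrite scalerA mulVf ?coef_neq0 // scale1r.
  have /memv_imgP[v _ ->] := subvsP (phi (t j)); by rewrite idemE eqxx.
(* Every [g] is some [t j] times an element of [K], so agreement at the [t j] spreads by
   equivariance. *)
move=> g; rewrite -[g](mulKVg (t (sg g i1))) ind_map_equivariant //.
by rewrite Et phiK.
Qed.

(** * Relative invariants and extensions of [psi] *)

Lemma extends_relative_invariant (h : homform V d) :
    jacobian h = jacobian f -> relative_invariant rho h ->
  exists chi : G -> F, linear_character predT chi /\ {in K, chi =1 psi}.
Proof.
move=> hJ [h0 h_line].
have /choice[chi chiP] g : exists c, act g h = c *: h.
  by apply/vlineP; rewrite -(h_line g isT) memv_img ?memv_line.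
have chi_inj a b : a *: h = b *: h -> a = b.
  move/eqP; rewrite -subr_eq0 -scalerBl scaler_eq0 (negPf h0) orbF subr_eq0.
  by move/eqP.
exists chi; split; [split=> [g _|g g' _ _]|move=> k kK].
- apply: contra h0 => /eqP g0; rewrite -(form_action_eq0 rho g) chiP g0.
  by rewrite scale0r.
- apply: chi_inj; rewrite -chiP form_actionM !chiP linearZ /= chiP.
  by rewrite scalerA mulrC.
have [c [c0 hE]] := (jacobian_eqP h).1 hJ.
have [v ev] := idem_neq0 i1.
(* On the block [W], [h] is [c i1] times [f_1]. Comparing derivatives of [k . h] along [W] then
   gives [chi k = psi k], because [c i1] is nonzero. *)
have De u : dirder h (e i1 u) = c i1 *: dirder (fi i1) u.
  rewrite hE dirder_sum_fi dirder_fi -linearZ /=; congr (dirder f _).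
  rewrite (bigD1 i1) //= idemE eqxx big1 ?addr0 // => j ji.
  by rewrite idemE (negPf ji) scaler0.
have ki : sg k i1 = i1 by apply/eqP; rewrite -stabilizerP.
have : dirder (act k h) (e i1 v) = (psi k * c i1) *: dirder (fi i1) v.
  rewrite -{1}(repr_funKV rho k v) -{1}ki -repr_idem -form_action_dirder De.
  by rewrite linearZ /= form_action_dirder psiP // dirderZl repr_funKV scalerA mulrC.
rewrite chiP dirderZl De scalerA => /eqP; rewrite -subr_eq0 -scalerBl -mulrBl.
rewrite scaler_eq0 mulf_eq0 (negPf (c0 i1)) orbF subr_eq0 dirder_fi.
by case/orP => [/eqP//|/eqP/f_nd ev0]; rewrite ev0 eqxx in ev.
Qed.

Variable chi : G -> F.
Hypothesis chiP : linear_character predT chi.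
Hypothesis chi_psi : {in K, chi =1 psi}.

Lemma chi_neq0 g : chi g != 0.
Proof. exact: chiP.1. Qed.

Lemma chiM g h : chi (g * h)%g = chi g * chi h.
Proof. exact: chiP.2. Qed.

(** Multiplying [h] on the right by [k] in [K] brings out [psi k] from the action and the inverse of
    [chi k] in front, and these cancel. *)
Lemma chi_action_coset g h : sg g i1 = sg h i1 ->
  (chi g)^-1 *: act g (fi i1) = (chi h)^-1 *: act h (fi i1).
Proof.
move=> gh; have kK : (h^-1 * g)%g \in K by rewrite stabilizerP sgM gh sgK.
rewrite -[g](mulKVg h) form_actionM psiP // -chi_psi // linearZ /= scalerA chiM.
by rewrite invfM divfK ?chi_neq0.
Qed.

(** Indexed by blocks, the terms become nonzero multiples [m j] of the block forms, and [g] sends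
    [m j] to [chi g] times [m (sg g j)]. Hence [g] scales the whole sum by [chi g]. *)
Lemma relative_invariant_form (t : 'I_r -> G) :
    (forall g, exists! i, ((t i)^-1 * g)%g \in K) ->
  let fchi := \sum_(i < r) (chi (t i))^-1 *: act (t i) (fi i1) in
  jacobian fchi = jacobian f /\ relative_invariant rho fchi.
Proof.
move=> tP fchi.
have memK i g : (((t i)^-1 * g)%g \in K) = (sg (t i) i1 == sg g i1).
  rewrite stabilizerP sgM; apply/eqP/eqP => [E|<-]; last by rewrite sgK.
  by rewrite -[in LHS]E sgKV.
(* Cosets of [K] correspond to blocks, so a transversal meets no block twice; injectivity on the
   finite index set then gives a bijection. *)
have t_inj : injective (fun i => sg (t i) i1).
  move=> i j ij; have [k [_ kU]] := tP (t j).
  by rewrite -(kU i) ?(kU j) // memK ?ij.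
have t_bij : bijective (fun i => sg (t i) i1) by exact: injF_bij.
have [s sP] := choice (sg_transitive i1).
pose m j := (chi (s j))^-1 *: act (s j) (fi i1).
have mE g : (chi g)^-1 *: act g (fi i1) = m (sg g i1).
  by apply: chi_action_coset; rewrite sP.
have fchiE : fchi = \sum_j m j.
  rewrite [RHS](reindex (fun i => sg (t i) i1)); last exact: onW_bij.
  by apply: eq_bigr => i _; exact: mE.
have fchiJ : jacobian fchi = jacobian f.
  apply/jacobian_eqP; exists (fun j => (chi (s j))^-1 * coef (s j) j); split=> [j|].
    by rewrite mulf_neq0 ?invr_eq0 ?chi_neq0 ?coef_neq0.
  by rewrite fchiE; apply: eq_bigr => j _; rewrite /m action_fi sP scalerA.
have fchi0 : fchi != 0.
  have [v ev] := idem_neq0 i1; apply: contra ev => /eqP fchi0; apply/eqP/f_nd.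
  have : dirder f (e i1 v) \in jacobian fchi.
    by rewrite fchiJ; apply/jacobianP; exists (e i1 v).
  by case/jacobianP=> u ->; rewrite fchi0 dirder0l.
have fchi_act g : act g fchi = chi g *: fchi.
  rewrite fchiE linear_sum scaler_sumr /= [RHS](reindex (sg g)); last first.
    by apply: onW_bij; exists (sg g^-1%g); [exact: sgK | exact: sgKV].
  apply: eq_bigr => j _; rewrite [m j]/m linearZ /= -form_actionM.
  have -> : m (sg g j) = (chi (g * s j)%g)^-1 *: act (g * s j)%g (fi i1).
    by rewrite mE sgM sP.
  by rewrite scalerA chiM invfM mulrA mulfV ?chi_neq0 // mul1r.
split=> //; split=> // g _; rewrite limg_line fchi_act.
apply/eqP; rewrite eqEsubv -!memvE memvZ ?memv_line //=.
by apply/vlineP; exists (chi g)^-1; rewrite scalerA mulVf ?chi_neq0 ?scale1r.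
Qed.

Lemma transversal_exists :
  exists t : 'I_r -> G, forall g, exists! i, ((t i)^-1 * g)%g \in K.
Proof.
have [t tP] := choice (sg_transitive i1); exists t => g; exists (sg g i1).
have memK i : (((t i)^-1 * g)%g \in K) = (i == sg g i1).
  rewrite stabilizerP sgM; apply/eqP/eqP => [E|<-].
    by rewrite -[LHS]tP -[in LHS]E sgKV.
  by rewrite -{2}(tP i) sgK.
by split=> [|j]; rewrite memK ?eqxx // => /eqP.
Qed.

End InvariantJacobian.

(** * Specialization to the complex field [R[i]] *)

Theorem theorem3p1 (R : realType) (G : groupType) (V : vectType R[i])
    (rho : representation G V) (d : nat) (f : homform V d)
    (r : nat) (e : 'I_r -> 'End(V)) (fi : 'I_r -> homform V d) (i1 : 'I_r)
    (hV : irreducible rho) (hd : (3 <= d)%N) (hf : f != 0)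
    (hJ : jacobian_invariant rho f)
    (he_inj : injective e)
    (he : forall x, primitive_idempotent (center f) x <-> exists i, x = e i)
    (hfi : forall i, is_center_twist f (e i) (fi i)) :
  let W := limg (e i1) in
  let f1 := fi i1 in
  let K := set_stabilizer rho W in
  (forall h : homform V d,
     jacobian h = jacobian f <->
     exists c : 'I_r -> R[i],
       (forall i, c i != 0) /\ h = \sum_(i < r) c i *: fi i) /\
  preserves_line rho K f1 /\
  forall psi : G -> R[i],
    (forall k, k \in K -> form_action rho d k f1 = psi k *: f1) ->
    [/\ linear_character K psi,
        iso_Ind K
          (sub_action (form_action rho d.-1) (U := jacobian f))
          (twist_action psi (sub_action rho (U := W))),
        (exists h : homform V d,
           jacobian h = jacobian f /\ relative_invariant rho h) <->
        (exists chi : G -> R[i],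
           linear_character predT chi /\ {in K, chi =1 psi})
      & forall (chi : G -> R[i]) (t : 'I_r -> G),
          linear_character predT chi -> {in K, chi =1 psi} ->
          t i1 = 1%g ->
          (forall g, exists! i, ((t i)^-1 * g)%g \in K) ->
          let fchi :=
            \sum_(i < r) (chi (t i))^-1 *: form_action rho d (t i) f1 in
          jacobian fchi = jacobian f /\ relative_invariant rho fchi].
Proof.
move=> W f1 K; split; [|split].
- exact: (jacobian_eqP hV hd hf hJ he_inj he hfi).
- exact: (stabilizer_preserves_line hV hd hf hJ he_inj he hfi).
move=> psi psiP; split.
- exact: (psi_linear_character hV hd hf hJ he_inj he hfi psiP).
- exact: (jacobian_iso_Ind hV hd hf hJ he_inj he hfi psiP).
- split=> [[h [hJh h_inv]]|[chi [chiP chi_psi]]].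
    exact: (extends_relative_invariant hV hd hf hJ he_inj he hfi psiP hJh h_inv).
  have [t tP] := transversal_exists hV hd hf hJ he_inj he i1.
  eexists; exact: (relative_invariant_form hV hd hf hJ he_inj he hfi psiP chiP chi_psi tP).
move=> chi t chiP chi_psi _ tP.
exact: (relative_invariant_form hV hd hf hJ he_inj he hfi psiP chiP chi_psi tP).
Qed.
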